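(* Let $l\geq 2$ be an integer and let $S=\{s_1,s_2,\dots,s_l\}$ be a set of positive integers with $1\leq s_1<s_2<\cdots<s_l$. Then there exists an infinite, not eventually periodic $S$-difference set $W\subseteq\mathbb{N}$ such that there exists a minimal additive complement to $W$.
   Context: $\mathbb{N}$ denotes the set of nonnegative integers. For $C,W\subseteq\mathbb{Z}$, write $C+W=\{c+w : c\in C,\ w\in W\}$. Additive complement: a set $C\subseteq\mathbb{Z}$ is an additive complement to $W\subseteq\mathbb{Z}$ if $C+W=\mathbb{Z}$. It is a minimal additive complement (also called minimal complement) to $W$ if in addition no proper subset of $C$ is an additive complement to $W$. Eventually periodic: a set $X$ of integers is eventually periodic if there exists a positive integer $T$ such that $x+T\in X$ for all sufficiently large integers $x\in X$. $S$-difference set: let $S$ be a finite set of positive integers with $|S|\geq 2$, and let $W=\{w_1<w_2<w_3<\cdots\}\subseteq\mathbb{N}$ be an infinite set, enumerated in increasing order. $W$ is an $S$-difference set if $w_{i+1}-w_i\in S$ for every $i\geq 1$, and for each $s\in S$ the equality $w_{i+1}-w_i=s$ holds for infinitely many indices $i$. An infinite, not eventually periodic $S$-difference set is an $S$-difference set that is not eventually periodic. *)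

(* Defs.v *)
From mathcomp Require Import all_boot all_order all_algebra.
From mathcomp Require Import all_classical.

Set Implicit Arguments.
Unset Strict Implicit.
Unset Printing Implicit Defensive.

Import Order.TTheory GRing.Theory Num.Theory.

Local Open Scope classical_set_scope.
Local Open Scope ring_scope.

Definition sumset (C W : set int) : set int := [set c + w | c in C & w in W].

Definition additive_complement (C W : set int) : Prop := sumset C W = setT.

Definition minimal_complement (C W : set int) : Prop :=
  additive_complement C W /\
  forall C' : set int, C' `<` C -> ~ additive_complement C' W.

Definition eventually_periodic (X : set int) : Prop :=
  exists2 T : int, 0 < T &
    exists N : int, forall x : int, X x -> N <= x -> X (x + T).

(* [w] enumerates [W] in increasing order; indices start at 0. *)
Definition increasing_enumeration (W : set int) (w : nat -> int) : Prop :=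
  (forall i j : nat, (i < j)%N -> w i < w j) /\ range w = W.

(* The enumeration of an infinite subset of the naturals is unique, so the
   existential over [w] only names it. The standing assumptions on [S] (finite,
   positive elements, at least two of them) are not part of this predicate. *)
Definition difference_set (S W : set int) : Prop :=
  [/\ (forall x : int, W x -> 0 <= x),
      infinite_set W &
      exists w : nat -> int,
        [/\ increasing_enumeration W w,
            (forall i : nat, S (w i.+1 - w i)) &
            (forall s : int, S s -> infinite_set [set i : nat | w i.+1 - w i = s])]].

(* Main.v *)
(** Let [a < b] be two elements of [S].  The complement is a sequence
    [C = {- c_k}], with a witness [n_k] for each [k]: an integer such that
    [n_k + c_j] is in [W] exactly when [j = k].  [W] is a concatenation of
    finite blocks.  The [k]-th one, seen through the translation by [- c_k], starts at
    [n_k], contains the [k]-th integer of an enumeration of the integers (unless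
    that integer is an earlier witness), and avoids [n_j] for [j < k].  Avoiding
    is possible greedily: step by [a], and by [b] when [a] would land on a
    forbidden point; this only needs that no two witnesses differ by [b - a].
    Since [n_k] is chosen after [c_j] for [j < k], it can be so negative that
    [n_k + c_j < 0], hence [n_k + c_j] is not in [W].

    Such a [W] cannot be eventually periodic: if [T] were a period, then
    [c_i = c_j] modulo [T] for some large [i < j], and [n_i + c_i] in [W] would
    force [n_i + c_j] in [W]. *)

Require Import Defs.
From mathcomp Require Import all_boot all_order all_algebra.
From mathcomp Require Import all_classical.
From mathcomp Require Import zify ring.

Set Implicit Arguments.
Unset Strict Implicit.
Unset Printing Implicit Defensive.

Import Order.TTheory GRing.Theory Num.Theory.

Local Open Scope classical_set_scope.
Local Open Scope ring_scope.

(** * Points reached from a start by a list of gaps *)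

Definition sumz (D : seq int) : int := \sum_(y <- D) y.

Lemma sumz_nil : sumz [::] = 0.
Proof. exact: big_nil. Qed.

Lemma sumz_cons y D : sumz (y :: D) = y + sumz D.
Proof. exact: big_cons. Qed.

(** Encoding a block by its start and its gaps makes translation act on the start alone and turns
    gluing of blocks into list concatenation. *)
Definition points (p : int) (D : seq int) : seq int := p :: scanl +%R p D.

Lemma points_nil p x : (x \in points p [::]) = (x == p).
Proof. exact: mem_seq1. Qed.

Lemma points_cons p y D x :
  (x \in points p (y :: D)) = (x == p) || (x \in points (p + y) D).
Proof. exact: in_cons. Qed.

Lemma points_head p D : p \in points p D.
Proof. exact: mem_head. Qed.

Lemma points_shift t p D x : (x + t \in points (p + t) D) = (x \in points p D).
Proof.
elim: D p => [|y D IH] p; first by rewrite !points_nil; lia.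
by rewrite !points_cons -IH addrAC (inj_eq (addIr t)).
Qed.

Lemma mem_points_cat p D E x :
  (x \in points p (D ++ E)) =
  (x \in points p D) || (x \in points (p + sumz D) E).
Proof.
elim: D p => [|z D IH] p.
  by rewrite sumz_nil addr0 points_nil; case: eqP => // ->; rewrite points_head.
by rewrite cat_cons !points_cons IH sumz_cons addrA orbA.
Qed.

Lemma points_last p D : p + sumz D \in points p D.
Proof. by rewrite -{2}(cats0 D) mem_points_cat points_nil eqxx orbT. Qed.

Lemma sum_ge_size (D : seq int) : {in D, forall y, 1 <= y} ->
  (size D)%:Z <= sumz D.
Proof.
elim: D => [|z D IH] Dge1; first by rewrite sumz_nil.
have z1 : 1 <= z by apply: Dge1; rewrite inE eqxx.
rewrite sumz_cons /=.
have /IH : {in D, forall y, 1 <= y}.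
  by move=> y yD; apply: Dge1; rewrite inE yD orbT.
by lia.
Qed.

Lemma points_bounds p D x : {in D, forall y, 1 <= y} -> x \in points p D ->
  p <= x <= p + sumz D.
Proof.
elim: D p => [|z D IH] p Dge1; first by rewrite sumz_nil points_nil; lia.
have z1 : 1 <= z by apply: Dge1; rewrite inE eqxx.
have D1 : {in D, forall y, 1 <= y}.
  by move=> y yD; apply: Dge1; rewrite inE yD orbT.
rewrite points_cons sumz_cons => /orP[/eqP->|/(IH _ D1)]; last by lia.
by have := sum_ge_size D1; lia.
Qed.

Lemma pointsP p D x :
  reflect (exists2 i, (i <= size D)%N & x = p + sumz (take i D))
          (x \in points p D).
Proof.
apply: (iffP idP) => [|[i iD ->]]; last first.
  by rewrite -{2}(cat_take_drop i D) mem_points_cat points_last.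
elim: D p => [|z D IH] p.
  by rewrite points_nil => /eqP->; exists 0%N; rewrite ?sumz_nil ?addr0.
rewrite points_cons => /orP[/eqP->|/IH[i iD ->]].
  by exists 0%N; rewrite ?sumz_nil ?addr0.
by exists i.+1; rewrite //= sumz_cons addrA.
Qed.

(** * Finite blocks avoiding forbidden points *)

Lemma avoid_right (S B : seq int) a b (t : nat) m :
  {in S, forall y, 1 <= y} -> a \in S -> b \in S ->
  {in B, forall x, x + (b - a) \notin B} ->
  m \notin B -> {in B, forall x, x < m + t%:Z} ->
  exists D, [/\ {subset D <= S}, {subset S <= D},
    {in points m D, forall x, x \notin B} &
    {in B, forall x, x < m + sumz D}].
Proof.
move=> S1 aS bS Bsep; have [a1 b1] := (S1 _ aS, S1 _ bS).
elim: t m => [|t IH] m mB Blt.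
  (* All of [B] lies below [m] here, so running once through [S] is safe and makes every gap
     occur. *)
  exists S; split=> // x xH.
    have/andP[xge _] := points_bounds S1 xH.
    by apply/negP => /Blt; lia.
  by have := Blt x xH; have := sum_ge_size S1; lia.
have step d : d \in S -> m + d \notin B -> exists D, [/\ {subset D <= S},
    {subset S <= D}, {in points m D, forall x, x \notin B} &
    {in B, forall x, x < m + sumz D}].
  move=> dS dB; have d1 := S1 _ dS.
  have [|D [DS SD DB Dlt]] := IH (m + d) dB.
    by move=> x /Blt; lia.
  exists (d :: D); split.
  - by move=> x; rewrite inE => /orP[/eqP->|/DS].
  - by move=> x /SD xD; rewrite inE xD orbT.
  - by move=> x; rewrite points_cons => /orP[/eqP->|/DB].
  - by move=> x /Dlt; rewrite sumz_cons; lia.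
have [maB|] := boolP (m + a \in B); last exact: step.
apply: (step b bS); rewrite (_ : m + b = m + a + (b - a)); last by ring.
exact: Bsep.
Qed.

(** Used to push the start of a block arbitrarily low without moving its end. Going backwards, [b]
    is tried first: if [n - b] is forbidden, separation frees [n - a]. *)
Lemma avoid_left (S B : seq int) a b (t : nat) m D :
  {in S, forall y, 1 <= y} -> a \in S -> b \in S ->
  {in B, forall x, x + (b - a) \notin B} ->
  {subset D <= S} -> {in points m D, forall x, x \notin B} ->
  exists n E, [/\ n <= m - t%:Z, {subset E <= S}, {subset D <= E},
    {in points n E, forall x, x \notin B} &
    m \in points n E /\ n + sumz E = m + sumz D].
Proof.
move=> S1 aS bS Bsep DS DB; have [a1 b1] := (S1 _ aS, S1 _ bS).
elim: t => [|t [n [E [nm ES DE EB [mE sE]]]]].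
  by exists m, D; split => //; [lia | rewrite points_head].
have step d : d \in S -> n - d \notin B -> exists n' E',
    [/\ n' <= m - t.+1%:Z, {subset E' <= S}, {subset D <= E'},
    {in points n' E', forall x, x \notin B} &
    m \in points n' E' /\ n' + sumz E' = m + sumz D].
  move=> dS dB; have d1 := S1 _ dS.
  exists (n - d), (d :: E); split.
  - by lia.
  - by move=> x; rewrite inE => /orP[/eqP->|/ES].
  - by move=> x /DE xD; rewrite inE xD orbT.
  - by move=> x; rewrite points_cons subrK => /orP[/eqP->|/EB].
  - by rewrite points_cons subrK mE orbT sumz_cons -sE; split=> //; ring.
have [nbB|] := boolP (n - b \in B); last exact: step.
apply: (step a aS); rewrite (_ : n - a = n - b + (b - a)); last by ring.
exact: Bsep.
Qed.

Lemma seq_bounded (B : seq int) m :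
  exists t : nat, {in B, forall x, x < m + t%:Z}.
Proof.
elim: B => [|y B [t Bt]]; first by exists 0%N.
exists (t + `|y - m|.+1)%N => x; rewrite inE => /orP[/eqP->|/Bt]; lia.
Qed.

Lemma avoiding_block (S B : seq int) a b z m :
  {in S, forall y, 1 <= y} -> a \in S -> b \in S -> a < b ->
  {in B, forall x, x + (b - a) \notin B} ->
  exists n D, [/\ n < z, {subset D <= S} /\ {subset S <= D},
    {in points n D, forall x, x \notin B},
    {in B, forall x, x < n + sumz D} &
    (m \in B) || (m \in points n D)].
Proof.
move=> S1 aS bS ab Bsep.
have main m' : m' \notin B -> exists n D, [/\ n < z,
    {subset D <= S} /\ {subset S <= D}, {in points n D, forall x, x \notin B},
    {in B, forall x, x < n + sumz D} & m' \in points n D].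
  move=> m'B; have [t Bt] := seq_bounded B m'.
  have [D [DS SD DB Blt]] := avoid_right S1 aS bS Bsep m'B Bt.
  have [n [E [nm ES DE EB [mE sE]]]] :=
    avoid_left `|m' - z|.+1 S1 aS bS Bsep DS DB.
  exists n, E; rewrite sE; split => //; first by lia.
  by split=> // x /SD/DE.
(* A forbidden [m] imposes nothing on the block, which is then built around [m + (b - a)], free by
   separation. *)
have [mB|/main[n [D [? ? ? ? mD]]]] := boolP (m \in B).
  by have [n [D [? ? ? ? _]]] := main _ (Bsep _ mB); exists n, D.
by exists n, D; rewrite mD orbT.
Qed.

(** * Recursive choice of blocks and witnesses *)

(** The translation carrying [n j] to the end of [L j] is by [c_j = sumz (L j) - n j], so the first
    bound on [n k] says that [n k + c_j] is negative. *)
Lemma block_sequence (S : seq int) a b :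
  {in S, forall y, 1 <= y} -> a \in S -> b \in S -> a < b ->
  exists (n : nat -> int) (L D : nat -> seq int),
  [/\ L 0%N = [::] /\ forall k, L k.+1 = L k ++ D k,
      forall k, {subset D k <= S} /\ {subset S <= D k},
      forall j k, (j < k)%N ->
        n k < n j - sumz (L j) /\ n k < n j,
      forall j k, (j < k)%N ->
        n j \notin points (n k) (D k) /\ n j < n k + sumz (D k) &
      forall m, exists k, m = n k \/ m \in points (n k) (D k)].
Proof.
move=> S1 aS bS ab.
(* Separation sits inside the chosen property so that [f] is total; without it the value is a
   dummy. *)
have /choice[f fP] : forall q : seq int * int * int, exists r : int * seq int,
    {in q.1.1, forall x, x + (b - a) \notin q.1.1} ->
    [/\ r.1 < q.1.2, {subset r.2 <= S} /\ {subset S <= r.2},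
    {in points r.1 r.2, forall x, x \notin q.1.1},
    {in q.1.1, forall x, x < r.1 + sumz r.2} &
    (q.2 \in q.1.1) || (q.2 \in points r.1 r.2)].
  move=> [[B z] m] /=.
  have [Bsep|nB] := pselect {in B, forall x, x + (b - a) \notin B}.
    by have [n [D H]] := avoiding_block z m S1 aS bS ab Bsep; exists (n, D).
  by exists (0, [::]) => /nB.
pose target k : int := odflt 0 (unpickle k).
pose blk k (s : seq int * int * seq int) := f (s.1.1, s.1.2, target k).
(* A state holds the witnesses so far, a bound below which the next one must
   lie, and the concatenation of the blocks so far. *)
pose fix st k : seq int * int * seq int := if k isn't k'.+1 then ([::], 0, [::])
  else let s := st k' in let r := blk k' s in
  (r.1 :: s.1.1, r.1 - (b - a) - sumz s.2, s.2 ++ r.2).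
pose n k := (blk k (st k)).1; pose D k := (blk k (st k)).2.
pose B k := (st k).1.1; pose z k := (st k).1.2; pose L k := (st k).2.
have LS k : L k.+1 = L k ++ D k by [].
have BS k : B k.+1 = n k :: B k by [].
(* Subtracting [b - a] keeps the witnesses separated; subtracting [sumz (L k)] makes later
   [n j + c_k] negative. *)
have zS k : z k.+1 = n k - (b - a) - sumz (L k) by [].
have BP k : {in B k, forall x, x + (b - a) \notin B k} /\
    {in B k, forall x, z k <= x - (b - a)} /\ {in L k, forall y, 1 <= y}.
  elim: k => [|k [Bsep [Bz L1]]]; first by split.
  have [/= nz [DS _] _ _ _] := fP (B k, z k, target k) Bsep.
  have L0 : 0 <= sumz (L k) by apply: le_trans (sum_ge_size L1).
  rewrite -/(n k) in nz; split; last split.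
  - move=> x; rewrite BS !inE negb_or => /orP[/eqP->|xB].
      apply/andP; split; first by lia.
      by apply/negP => /Bz; lia.
    by rewrite (Bsep _ xB) andbT; have := Bz _ xB; lia.
  - by move=> x; rewrite BS zS inE => /orP[/eqP->|/Bz]; lia.
  - by move=> y; rewrite LS mem_cat => /orP[/L1|/DS/S1].
have L0 k : 0 <= sumz (L k).
  by have [_ [_ L1]] := BP k; apply: le_trans (sum_ge_size L1).
have blkP k : [/\ n k < z k, {subset D k <= S} /\ {subset S <= D k},
    {in points (n k) (D k), forall x, x \notin B k},
    {in B k, forall x, x < n k + sumz (D k)} &
    (target k \in B k) || (target k \in points (n k) (D k))].
  by have [Bsep _] := BP k; exact: fP (B k, z k, target k) Bsep.
have nB j k : (j < k)%N -> n j \in B k.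
  elim: k => // k IH; rewrite ltnS leq_eqVlt BS inE.
  by case/orP=> [/eqP->|/IH->]; rewrite ?eqxx ?orbT.
have Bn k x : x \in B k -> exists j, x = n j.
  by elim: k => // k IH; rewrite BS inE => /orP[/eqP->|//]; exists k.
exists n, L, D; split => //.
- by move=> k; have [] := blkP k.
- move=> j; elim=> // k IH; rewrite ltnS leq_eqVlt => /orP[/eqP->|jk].
    by have [] := blkP k.+1; rewrite zS; have := L0 k; lia.
  have := IH jk; have [] := blkP k.+1; rewrite zS; have := L0 k; lia.
- move=> j k /nB jB; have [_ _ avoid lt _] := blkP k; split; last exact: lt.
  by apply/negP => /avoid; rewrite jB.
- move=> m; have tm : target (pickle m) = m by rewrite /target pickleK.
  have [_ _ _ _] := blkP (pickle m); rewrite tm => /orP[/Bn[j ->]|mD].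
    by exists j; left.
  by exists (pickle m); right.
Qed.

(** * The concatenated blocks form a difference set *)

Lemma unbounded_infinite (X : set int) :
  (forall t : nat, exists2 x, X x & t%:Z <= x) -> infinite_set X.
Proof.
move=> Xub /finite_seqP[r Xr]; have [t rt] := seq_bounded r 0.
by have [x] := Xub t; rewrite Xr /= => /rt; lia.
Qed.

Lemma chain_prefix (L D : nat -> seq int) j k :
  (forall k, L k.+1 = L k ++ D k) -> (j <= k)%N -> exists R, L k = L j ++ R.
Proof.
move=> LS; elim: k => [|k IH].
  by rewrite leqn0 => /eqP->; exists [::]; rewrite cats0.
rewrite leq_eqVlt => /orP[/eqP->|]; first by exists [::]; rewrite cats0.
by rewrite ltnS => /IH[R LR]; exists (R ++ D k); rewrite LS LR catA.
Qed.

Lemma chain_difference_set (S : seq int) (L D : nat -> seq int) a :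
  {in S, forall y, 1 <= y} -> a \in S -> L 0%N = [::] ->
  (forall k, L k.+1 = L k ++ D k) ->
  (forall k, {subset D k <= S} /\ {subset S <= D k}) ->
  difference_set [set x | x \in S] [set x | exists k, x \in points 0 (L k)].
Proof.
move=> S1 aS L0 LS DS.
have LsubS k : {subset L k <= S}.
  elim: k => [|k IH] x; first by rewrite L0.
  by rewrite LS mem_cat => /orP[/IH|/(DS k).1].
have L1 k : {in L k, forall y, 1 <= y} by move=> y /LsubS/S1.
have Lsize k : (k <= size (L k))%N.
  elim: k => // k IH; rewrite LS size_cat.
  by have := (DS k).2 _ aS; case: (D k) => //= *; lia.
(* [L i] has at least [i] gaps since no block is empty, and any other long enough [L k] gives the
   same value. *)
pose w i := sumz (take i (L i)).
have wE i k : (i <= size (L k))%N -> w i = sumz (take i (L k)).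
  move=> iLk; have iLi := Lsize i; rewrite /w; congr sumz.
  case/orP: (leq_total i k) => /(chain_prefix LS)[R ->];
    by rewrite takel_cat.
have step i k : (i < size (L k))%N -> w i.+1 - w i = nth 0 (L k) i.
  move=> iLk; rewrite (wE _ _ iLk) (wE _ _ (ltnW iLk)) (take_nth 0 iLk).
  by rewrite /sumz big_rcons /=; ring.
have stepS i : w i.+1 - w i \in S.
  by rewrite (step i i.+1) //; apply/(LsubS i.+1)/mem_nth.
have w_lt : {homo w : i j / (i < j)%N >-> i < j}.
  apply: homo_ltn => [y x z|k]; first exact: lt_trans.
  by have := S1 _ (stepS k); lia.
split.
- by move=> x [k /(points_bounds (L1 k))/andP[]].
- apply: unbounded_infinite => t; exists (sumz (L t)).
    by exists t; rewrite -[X in X \in _]add0r points_last.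
  by have := sum_ge_size (L1 t); have := Lsize t; lia.
exists w; split=> //.
- split; first exact: w_lt.
  apply/seteqP; split=> [_ [i _ <-]|x [k /pointsP[i iL ->]]].
    by exists i; apply/pointsP; exists i; rewrite ?add0r ?Lsize.
  by exists i => //; rewrite (wE _ _ iL) add0r.
- move=> s sS fin; apply: unbounded_infinite (finite_image Posz fin) => t.
  (* The gap [s] occurs in block [t], hence at an index at least [size (L t)], which is at least
     [t]. *)
  have sD := (DS t).2 _ sS.
  have lt : (size (L t) + index s (D t) < size (L t.+1))%N.
    by rewrite LS size_cat ltn_add2l index_mem.
  exists (size (L t) + index s (D t))%:Z; last by have := Lsize t; lia.
  exists (size (L t) + index s (D t))%N => //=.
  by rewrite (step _ _ lt) LS nth_cat ltnNge leq_addr /= addKn nth_index.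
Qed.

(** * Periods and residues *)

Lemma eventually_periodic_mul (X : set int) : eventually_periodic X ->
  exists2 T : nat, (0 < T)%N & exists N : int, forall x (q : nat),
    X x -> N <= x -> X (x + (q * T)%:Z).
Proof.
case=> T T0 [N per]; exists `|T|%N; first by lia.
exists N => x q Xx Nx; elim: q => [|q IH]; first by rewrite mul0n addr0.
rewrite (_ : x + _ = x + (q * `|T|)%:Z + T); last by rewrite mulSn PoszD; lia.
by apply: per => //; lia.
Qed.

(** Pigeonhole on [T + 1] consecutive indices from [m]. *)
Lemma residue_collision (T : nat) (c : nat -> int) (m : nat) : (0 < T)%N ->
  exists i j, [/\ (m <= i)%N, (i < j)%N & (T%:Z %| c j - c i)%Z].
Proof.
case: T => // T _.
pose f (i : 'I_T.+2) : 'I_T.+1 := inord `|(c (m + i)%N %% T.+1%:Z)%Z|.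
have /injectivePn[i [j ij fij]] : ~~ injectiveb f.
  by apply/negP => /injectiveP/leq_card; rewrite !card_ord ltnn.
have {}fij : (c (m + i)%N = c (m + j)%N %[mod T.+1%:Z])%Z.
  have lt k : (`|(c k %% T.+1%:Z)%Z|%N < T.+1)%N.
    have := ltz_mod (c k) (isT : T.+1%:Z != 0).
    by have := modz_ge0 (c k) (isT : T.+1%:Z != 0); lia.
  have := congr1 val fij; rewrite /= !inordK //.
  by have := modz_ge0 (c (m + i)%N) (isT : T.+1%:Z != 0);
     have := modz_ge0 (c (m + j)%N) (isT : T.+1%:Z != 0); lia.
case: (ltngtP i j) => [lt|lt|/val_inj eq]; last by rewrite eq eqxx in ij.
- exists (m + i)%N, (m + j)%N; rewrite leq_addr ltn_add2l; split=> //.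
  by rewrite -eqz_mod_dvd fij.
- exists (m + j)%N, (m + i)%N; rewrite leq_addr ltn_add2l; split=> //.
  by rewrite -eqz_mod_dvd fij.
Qed.

(** * Minimality from witnesses, and the theorem *)

(** Writing [n k = - c j + y] with [y] in [W] forces [j = k], so no complement inside the range can
    omit [- c k]. *)
Lemma minimal_complement_witnesses (W : set int) (n c : nat -> int) :
  (forall m, exists k, W (m + c k)) ->
  (forall k, W (n k + c k)) -> (forall j k, j <> k -> ~ W (n j + c k)) ->
  minimal_complement (range (fun k => - c k)) W.
Proof.
move=> cover hit miss; split.
  apply/seteqP; split=> // m _; have [k Wk] := cover m.
  by exists (- c k); [exists k | exists (m + c k) => //; ring].
move=> C' [C'C CC'] C'W; apply: CC' => _ [k _ <-].
have : sumset C' W (n k) by rewrite C'W.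
case=> x C'x [y Wy xy]; have [j _ jx] := C'C _ C'x.
have [<-|/eqP kj] := eqVneq j k; first by rewrite jx.
case: (@miss k j); first by move=> e; apply: kj.
by rewrite -xy -jx addrAC addNr add0r.
Qed.

Theorem theorem1p1 (l : nat) (hl : (2 <= l)%N) (s : 'I_l -> int)
    (s_ge1 : forall i : 'I_l, 1 <= s i)
    (s_incr : forall i j : 'I_l, (i < j)%N -> s i < s j) :
  exists W : set int,
    [/\ difference_set (range s) W,
        ~ eventually_periodic W &
        exists C : set int, minimal_complement C W].
Proof.
pose S := codom s.
have S1 : {in S, forall y, 1 <= y} by move=> _ /codomP[i ->].
have ab : s (Ordinal (ltnW hl)) < s (Ordinal hl) by exact: s_incr.
have [aS bS] := (codom_f s (Ordinal (ltnW hl)), codom_f s (Ordinal hl)).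
have [n [L [D [[L0 LS] DS n_lt fresh cover]]]] := block_sequence S1 aS bS ab.
pose W : set int := [set x | exists k, x \in points 0 (L k)].
pose c k := sumz (L k) - n k.
have rangeS : range s = [set x | x \in S].
  apply/seteqP; split=> [_ [i _ <-]|x /codomP[i ->]]; last by exists i.
  exact: codom_f.
have diffW : difference_set (range s) W.
  by rewrite rangeS; exact: chain_difference_set S1 aS L0 LS DS.
have W0 x : W x -> 0 <= x by case: diffW => + _ _; apply.
have DW k x : x \in points (n k) (D k) -> W (x + c k).
  rewrite -(points_shift (c k)) => xD; exists k.+1.
  rewrite LS mem_points_cat add0r.
  by rewrite (_ : sumz _ = n k + c k) ?xD ?orbT // /c; ring.
have hit k : W (n k + c k) by apply/DW/points_head.
have D1 k : {in D k, forall y, 1 <= y} by move=> y /(DS k).1/S1.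
have L1 k : {in L k, forall y, 1 <= y}.
  elim: k => [|k IH] x; first by rewrite L0.
  by rewrite LS mem_cat => /orP[/IH|/D1].
have size_le k : k%:Z <= sumz (L k).
  elim: k => [|k IH]; first by rewrite L0 sumz_nil.
  have := (DS k).2 _ aS; rewrite LS /sumz big_cat /= -!/(sumz _).
  have := sum_ge_size (D1 k); case: (D k) => //= *; lia.
(* The point [n j + c k] is past the end of [L k]; the translated block [k] avoids it and ends
   beyond it, so later blocks miss it too. *)
have miss_after j k : (j < k)%N -> ~ W (n j + c k).
  move=> jk [i]; have [njD nj_lt] := fresh _ _ jk.
  have [_ nk_lt] := n_lt _ _ jk.
  have beyond : n j + c k > sumz (L k) by rewrite /c; lia.
  case/orP: (leq_total i k) => [/(chain_prefix LS)[R LR]|].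
    move=> xL; suff : n j + c k \in points 0 (L k).
      by move/(points_bounds (L1 k)); lia.
    by rewrite LR mem_points_cat xL.
  rewrite leq_eqVlt => /orP[/eqP<-|/(chain_prefix LS)[R LR]].
    by move/(points_bounds (L1 k)); lia.
  have R1 : {in R, forall y, 1 <= y}.
    by move=> y yR; apply: (L1 i); rewrite LR mem_cat yR orbT.
  rewrite LR LS -catA !mem_points_cat add0r => /or3P[|xD|].
  - by move/(points_bounds (L1 k)); lia.
  - move: xD; rewrite (_ : sumz _ = n k + c k); last by rewrite /c; ring.
    by rewrite points_shift (negbTE njD).
  - by move/(points_bounds R1); rewrite /c; lia.
have miss j k : j <> k -> ~ W (n j + c k).
  case: (ltngtP j k) => // [jk _|kj _]; first exact: miss_after.
  by move/W0; have [] := n_lt _ _ kj; rewrite /c; lia.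
exists W; split=> //.
  move/eventually_periodic_mul => [T T0 [N per]].
  (* Indices from [|N|] on suffice: [n i + c i = sumz (L i)] is at least [i], hence at least [N]. *)
  have [i [j [Ni ij /dvdzP[q cq]]]] := residue_collision c `|N| T0.
  apply: (miss_after i j ij).
  (* Since [n j < n i - sumz (L i)], the difference [c j - c i] exceeds [sumz (L j)], so the period
     is applied upwards. *)
  have q0 : 0 <= q.
    by have := n_lt _ _ ij; have := size_le j; move: cq; rewrite /c; nia.
  have -> : n i + c j = n i + c i + (`|q| * T)%:Z.
    by rewrite PoszM gez0_abs // -cq; ring.
  by apply: (per _ _ (hit i)); have := size_le i; rewrite /c; lia.
exists (range (fun k => - c k)).
apply: (@minimal_complement_witnesses _ n) => //.
by move=> m; have [k [->|/DW]] := cover m; exists k.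
Qed.
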